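(* Let $a_9(n)$ be defined by $\sum_{n\geq 0}a_9(n)q^n=\frac{f_9f_{18}}{f_1f_2}$, where $f_k=\prod_{m\geq1}(1-q^{km})$. Define integers $m_{i,j}$ for $i,j\geq 1$ as follows: $m_{i,j}=0$ whenever $j>i$; $m_{1,1}=3$; $m_{2,1}=2$, $m_{2,2}=3^3$; $m_{3,1}=1$, $m_{3,2}=3^3$, $m_{3,3}=3^5$; and for $i\geq 4$, $m_{i,1}=0$ and for $j\geq 2$, \[m_{i,j}=9m_{i-1,j-1}+3m_{i-2,j-1}+m_{i-3,j-1}.\] Define the infinite matrix $C=(c_{i,j})_{i,j\geq1}$ by $c_{i,j}=m_{4i,\,i+j}$, and row vectors $\mathbf{Y}_\alpha=(y_{\alpha,1},y_{\alpha,2},\dots)$ by $\mathbf{Y}_0=(3,0,0,\dots)$ and $\mathbf{Y}_{\alpha+1}=\mathbf{Y}_\alpha C$. Then for each $\alpha\geq 0$, \[\sum_{n\geq0}a_9\left(3^{\alpha+1}n+3^{\alpha+1}-1\right)q^n=\sum_{i\geq1}y_{\alpha,i}\,q^{i-1}\left(\frac{f_3f_6}{f_1f_2}\right)^{4i}.\]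
   Context: $a_9(n)$ counts 9-regular cubic partitions of $n$. The products $\mathbf{Y}_\alpha C$ are finite sums since each $\mathbf{Y}_\alpha$ has finitely many nonzero entries. *)

(* Defs.v *)
From mathcomp Require Import all_boot all_order all_algebra.
Set Implicit Arguments. Unset Strict Implicit. Unset Printing Implicit Defensive.
Import Order.TTheory GRing.Theory Num.Theory.
Local Open Scope ring_scope.

(* Formal q-series are handled through their coefficients, using polynomial
   truncations in {poly int}.  For k >= 1 and N >= n, the coefficient of q^n
   of the polynomials below coincides with that of the true infinite series. *)

Definition fk (k N : nat) : {poly int} :=
  \prod_(1 <= m < N.+1) (1 - 'X^(k * m)).

(* Truncation of 1/f_k = prod_{m>=1} sum_{j>=0} q^{kmj}: m = 1..N, j = 0..N. *)
Definition fk_inv (k N : nat) : {poly int} :=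
  \prod_(1 <= m < N.+1) \sum_(0 <= j < N.+1) 'X^(k * m * j).

Definition a9 (n : nat) : int :=
  (fk 9 n * fk 18 n * fk_inv 1 n * fk_inv 2 n)`_n.

Definition Hser (N : nat) : {poly int} :=
  fk 3 N * fk 6 N * fk_inv 1 N * fk_inv 2 N.

(* m_{i,j} (indices i, j >= 1; index 0 is unused and set to 0). *)
Fixpoint mm (i j : nat) {struct i} : int :=
  match i with
  | 0 => 0
  | 1 => if j == 1%N then 3 else 0
  | 2 => if j == 1%N then 2 else if j == 2%N then 3 ^+ 3 else 0
  | 3 => if j == 1%N then 1 else if j == 2%N then 3 ^+ 3
         else if j == 3%N then 3 ^+ 5 else 0
  | S ((S ((S k) as k1)) as k2) =>
      if (i < j)%N then 0 else
      match j with
      | 0 | 1 => 0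
      | S j' => 9 * mm k2 j' + 3 * mm k1 j' + mm k j'
      end
  end.

Definition cc (i j : nat) : int := mm (4 * i) (i + j).

(* Y_alpha as a function of the index i >= 1.  Y_alpha is supported on
   1 <= i <= 3^alpha (since m_{i,j} = 0 for j > i gives c_{i,j} = 0 for
   j > 3i), so the product Y_alpha C is the finite sum over that range. *)
Fixpoint Y (alpha : nat) (j : nat) : int :=
  match alpha with
  | 0 => if j == 1%N then 3 else 0
  | S a => \sum_(1 <= i < (3 ^ a).+1) Y a i * cc i j
  end.

(* Main.v *)
(* By the triple product, D = f_1 f_2 equals phi(-q) psi(q);
   splitting both theta series modulo 3 gives
     D = A - q f_9 f_18 + C
   where A and C / q^2 are series in q^3 and A C = -2 q^2 (f_9 f_18)^2.  The
   product of D over the three conjugates q -> w q (w^3 = 1) is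
   (f_3 f_6)^4 / (f_9 f_18), so for eta = q f_9 f_18 / (f_1 f_2) and
   T(q) = q (f_3 f_6 / (f_1 f_2))^4 this becomes the cubic equation
     eta^3 = T(q^3) (1 + 3 eta + 9 eta^2).
   Let U keep the exponents divisible by 3 and divide them by 3.  The cubic
   yields U(eta^i) = sum_j m_{i,j} T^j, and eta^4 = T T(q^3) turns this into
   U(T^i) = sum_j c_{i,j} T^j.  The theorem is the expansion of U^(alpha+1) eta
   obtained from U eta = 3 T. *)
From HB Require Import structures.
Require Import Defs.
From mathcomp Require Import all_boot all_order all_algebra.
From mathcomp Require Import boolp ring zify.
Import GRing.Theory Num.Theory.
Local Open Scope ring_scope.

Set Implicit Arguments.
Unset Strict Implicit.
Unset Printing Implicit Defensive.

(** * Formal power series *)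

(** The product over conjugates is taken without adjoining w: a series a(q^3) + q b(q^3) + q^2
    c(q^3) is sent to the norm form a^3 + q b^3 + q^2 c^3 - 3qabc, whose multiplicativity is a
    polynomial identity over any commutative ring. Multiplied by powers of eta, the cubic gives only
    the recurrence; the seeds U(eta) and U(eta^2) need a separate argument. Dividing the cubic by
    eta and by eta^2 leaves T(q^3)/eta and T(q^3)/eta^2. These are a series in q^3 times q^2 D and q
    D^2 respectively, so U of both is read off the splitting of D: it gives -T and -3T. This is the
    origin of m_{1,1} = 9 - 3 - 3 and m_{2,1} = 3 - 1. *)

Record fps (R : Type) := Fps { fpsfun :> nat -> R }.

Lemma fpsP (R : Type) (f g : fps R) : (forall n, f n = g n) -> f = g.
Proof. by case: f g => [f] [g] fg; congr Fps; apply/funext. Qed.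

HB.instance Definition _ (R : Type) := gen_eqMixin (fps R).
HB.instance Definition _ (R : Type) := gen_choiceMixin (fps R).

Section Ring.
Variable R : comNzRingType.
Implicit Types (f g h : fps R) (p : {poly R}).

Definition fps0 : fps R := Fps (fun=> 0).
Definition fps_opp f : fps R := Fps (fun n => - f n).
Definition fps_add f g : fps R := Fps (fun n => f n + g n).

Lemma fps_addA : associative fps_add.
Proof. by move=> f g h; apply: fpsP => n /=; rewrite addrA. Qed.
Lemma fps_addC : commutative fps_add.
Proof. by move=> f g; apply: fpsP => n /=; rewrite addrC. Qed.
Lemma fps_add0 : left_id fps0 fps_add.
Proof. by move=> f; apply: fpsP => n /=; rewrite add0r. Qed.
Lemma fps_addN : left_inverse fps0 fps_opp fps_add.
Proof. by move=> f; apply: fpsP => n /=; rewrite addNr. Qed.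

HB.instance Definition _ :=
  GRing.isZmodule.Build (fps R) fps_addA fps_addC fps_add0 fps_addN.

Definition trunc N f : {poly R} := \poly_(i < N) f i.
Definition fps_of p : fps R := Fps (fun n => p`_n).

Definition fps_mul f g : fps R :=
  Fps (fun n => \sum_(j < n.+1) f j * g (n - j)%N).

(** The ring laws are inherited from [{poly R}]: a coefficient of a Cauchy product depends on
    finitely many coefficients of the factors, so each law can be checked on truncations. *)
Lemma fps_mul_poly N (p q : {poly R}) f g :
  (forall i, (i < N)%N -> f i = p`_i) -> (forall i, (i < N)%N -> g i = q`_i) ->
  forall i, (i < N)%N -> fps_mul f g i = (p * q)`_i.
Proof.
move=> fp gq i iN; rewrite coefM /=; apply: eq_bigr => j _.
by have := ltn_ord j; rewrite ltnS => ji; rewrite fp ?gq //; lia.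
Qed.

Lemma coef_trunc N f i : (i < N)%N -> f i = (trunc N f)`_i.
Proof. by move=> iN; rewrite coef_poly iN. Qed.

Lemma fps_mulA : associative fps_mul.
Proof.
move=> f g h; apply: fpsP => n.
have H := @coef_trunc n.+1.
rewrite (fps_mul_poly (H f) (fps_mul_poly (H g) (H h))) //.
by rewrite (fps_mul_poly (fps_mul_poly (H f) (H g)) (H h)) // mulrA.
Qed.

Lemma fps_mulC : commutative fps_mul.
Proof.
move=> f g; apply: fpsP => n; have H := @coef_trunc n.+1.
by rewrite (fps_mul_poly (H f) (H g)) // (fps_mul_poly (H g) (H f)) // mulrC.
Qed.

Lemma fps_mul1 : left_id (fps_of 1) fps_mul.
Proof.
move=> f; apply: fpsP => n; have H := @coef_trunc n.+1.
by rewrite (@fps_mul_poly n.+1 1 (trunc n.+1 f) _ _ _ (H f)) // mul1r -H.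
Qed.

Lemma fps_mulD : left_distributive fps_mul fps_add.
Proof.
move=> f g h; apply: fpsP => n /=.
by rewrite -big_split; apply: eq_bigr => j _; rewrite mulrDl.
Qed.

Lemma fps_one_neq0 : fps_of 1 != fps0.
Proof.
apply/eqP => /(congr1 (fun f : fps R => f 0)) /=.
by rewrite coefC /=; apply/eqP/oner_neq0.
Qed.

HB.instance Definition _ :=
  GRing.Zmodule_isComNzRing.Build (fps R)
    fps_mulA fps_mulC fps_mul1 fps_mulD fps_one_neq0.

Lemma fcoefD f g n : (f + g) n = f n + g n. Proof. by []. Qed.
Lemma fcoefN f n : (- f) n = - f n. Proof. by []. Qed.
Lemma fcoefB f g n : (f - g) n = f n - g n. Proof. by []. Qed.
Lemma fcoefMn f k n : (f *+ k) n = f n *+ k.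
Proof. by elim: k => // k IH; rewrite !mulrS fcoefD IH. Qed.

Lemma fcoef_sum (I : Type) (r : seq I) (P : pred I) (F : I -> fps R) n :
  (\sum_(i <- r | P i) F i) n = \sum_(i <- r | P i) F i n.
Proof. by apply: (big_morph (fun f : fps R => f n)). Qed.

Lemma fps_of_is_additive : additive fps_of.
Proof. by move=> p q; apply: fpsP => n /=; rewrite coefB. Qed.

Lemma fps_of_is_monoid_morphism : monoid_morphism fps_of.
Proof.
split=> // p q; apply: fpsP => n /=.
by rewrite coefM; apply: eq_bigr.
Qed.

HB.instance Definition _ :=
  GRing.isZmodMorphism.Build {poly R} (fps R) fps_of fps_of_is_additive.
HB.instance Definition _ :=
  GRing.isMonoidMorphism.Build {poly R} (fps R) fps_of
    fps_of_is_monoid_morphism.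

Definition q : fps R := fps_of 'X.

Lemma fps_ofXn k : fps_of 'X^k = q ^+ k.
Proof. exact: rmorphXn. Qed.

Lemma fcoef_qn k n : (q ^+ k) n = (n == k)%:R.
Proof. by rewrite -fps_ofXn /= coefXn. Qed.

Lemma fcoefM f g n : (f * g) n = \sum_(j < n.+1) f j * g (n - j)%N.
Proof. by []. Qed.

Lemma fcoefM0 f g : (f * g) 0 = f 0 * g 0.
Proof. by rewrite fcoefM big_ord1. Qed.

Lemma fcoef1_0 : (1 : fps R) 0 = 1.
Proof. by rewrite /= coef1. Qed.

Lemma fcoef_qnM k f n : (q ^+ k * f) n = if (n < k)%N then 0 else f (n - k)%N.
Proof.
have H := @coef_trunc n.+1.
have Hq i : (i < n.+1)%N -> (q ^+ k) i = ('X^k : {poly R})`_i.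
  by rewrite fcoef_qn coefXn.
by rewrite (fps_mul_poly Hq (H f)) // coefXnM -H //; lia.
Qed.

Lemma q_cancel k f g : q ^+ k * f = q ^+ k * g -> f = g.
Proof.
move=> fg; apply: fpsP => n; have := congr1 (fun h : fps R => h (k + n)%N) fg.
by rewrite !fcoef_qnM ltnNge leq_addr addKn.
Qed.

Definition eqm N f g := forall i, (i < N)%N -> f i = g i.

Lemma eqm_refl N f : eqm N f f. Proof. by []. Qed.
Lemma eqm_sym N f g : eqm N f g -> eqm N g f.
Proof. by move=> fg i iN; rewrite fg. Qed.
Lemma eqm_trans N g f h : eqm N f g -> eqm N g h -> eqm N f h.
Proof. by move=> fg gh i iN; rewrite fg ?gh. Qed.
Lemma eqm_le M N f g : (M <= N)%N -> eqm N f g -> eqm M f g.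
Proof. by move=> MN fg i iM; apply: fg; apply: leq_trans MN. Qed.
Lemma eqmD N f f' g g' : eqm N f f' -> eqm N g g' -> eqm N (f + g) (f' + g').
Proof. by move=> ff gg i iN; rewrite !fcoefD ff ?gg. Qed.
Lemma eqmN N f f' : eqm N f f' -> eqm N (- f) (- f').
Proof. by move=> ff i iN; rewrite !fcoefN ff. Qed.
Lemma eqmB N f f' g g' : eqm N f f' -> eqm N g g' -> eqm N (f - g) (f' - g').
Proof. by move=> ff gg; apply: eqmD => //; apply: eqmN. Qed.
Lemma eqmM N f f' g g' : eqm N f f' -> eqm N g g' -> eqm N (f * g) (f' * g').
Proof.
move=> ff gg i iN; rewrite !fcoefM; apply: eq_bigr => j _.
by have := ltn_ord j; rewrite ltnS => ji; rewrite ff ?gg //; lia.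
Qed.
Lemma eqmX N f f' k : eqm N f f' -> eqm N (f ^+ k) (f' ^+ k).
Proof. by move=> ff; elim: k => // k IH; rewrite !exprS; apply: eqmM. Qed.

Lemma eqm_qn N k f : (N <= k)%N -> eqm N (q ^+ k * f) 0.
Proof. by move=> Nk i iN; rewrite fcoef_qnM (leq_trans iN). Qed.

Lemma eqm0P N f : eqm N f 0 -> exists g, f = q ^+ N * g.
Proof.
move=> f0; exists (Fps (fun n => f (N + n)%N)); apply: fpsP => n.
by rewrite fcoef_qnM; case: ltnP => [/f0|/subnKC <-] //=; rewrite addKn.
Qed.

Lemma eqm0M M N f g : eqm M f 0 -> eqm N g 0 -> eqm (M + N) (f * g) 0.
Proof.
move=> /eqm0P[f' ->] /eqm0P[g' ->]; rewrite mulrACA -exprD; exact: eqm_qn.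
Qed.

Lemma eqmP N f g : eqm N f g <-> eqm N (f - g) 0.
Proof.
split=> fg i iN; first by rewrite fcoefB fg ?subrr.
by apply/eqP; rewrite -subr_eq0 -fcoefB fg.
Qed.

(* The limit of a sequence whose [n]-th step does not change the first
   [n.+1] coefficients. *)
Definition diag (s : nat -> fps R) : fps R := Fps (fun n => s n n).

Lemma eqm_diag s : (forall n, eqm n.+1 (s n.+1) (s n)) ->
  forall n, eqm n.+1 (s n) (diag s).
Proof.
move=> ss n i ni /=; rewrite -(subnKC (ltnSE ni)).
elim: (n - i)%N => [|k IH]; first by rewrite addn0.
by rewrite addnS -IH ss //; lia.
Qed.

(** Geometric series for 1/(1 - (1 - f)), an inverse when [f 0 = 1]: then (1 - f)^i has no term
    below q^i, so coefficient [n] needs only [i <= n]. *)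
Definition fps_inv f := diag (fun n => \sum_(i < n.+1) (1 - f) ^+ i).

Lemma mul_fps_inv f : f 0 = 1 -> f * fps_inv f = 1.
Proof.
move=> f0.
have H k : eqm k ((1 - f) ^+ k) 0.
  have H1 : eqm 1 (1 - f) 0.
    by case=> // _; rewrite fcoefB f0 fcoef1_0 subrr.
  elim: k => // k IH; rewrite exprS; exact: (@eqm0M 1).
have K n : eqm n.+1 (\sum_(i < n.+1) (1 - f) ^+ i) (fps_inv f).
  apply: (@eqm_diag (fun n => \sum_(i < n.+1) (1 - f) ^+ i)) => m.
  rewrite [X in eqm _ X _]big_ord_recr /= -[X in eqm _ _ X]addr0.
  by apply: eqmD => //; apply: H.
apply: fpsP => n.
have -> : (f * fps_inv f) n = (f * \sum_(i < n.+1) (1 - f) ^+ i) n.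
  by apply: (@eqmM n.+1) => //; apply: eqm_sym.
have {1}-> : f = - ((1 - f) - 1) by ring.
by rewrite mulNr -subrX1 opprB fcoefB (H n.+1) // subr0.
Qed.

Lemma mulI_unit f g h : f 0 = 1 -> f * g = f * h -> g = h.
Proof.
move=> /mul_fps_inv f1 fgh.
have H x : x = fps_inv f * (f * x) by rewrite mulrA (mulrC _ f) f1 mul1r.
by rewrite (H g) fgh -H.
Qed.

End Ring.

(** * Coefficientwise limits, dissection modulo 3 and the cubic norm *)

Section Limits.
Variable R : comNzRingType.
Implicit Types (f g h a b c : fps R) (s t : nat -> fps R).
Local Notation q := (q R).

(** q-adic convergence without a rate: regrouped products and bilateral sums settle their
    coefficients at different speeds, and are compared through [tends_uniq]. *)
Definition tends s f :=
  forall N, exists M, forall m, (M <= m)%N -> eqm N (s m) f.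

Lemma tends_cst f : tends (fun=> f) f.
Proof. by move=> N; exists 0. Qed.

Lemma eq_tends s t f : s =1 t -> tends s f -> tends t f.
Proof.
by move=> st sf N; have [M HM] := sf N; exists M => m /HM; rewrite st.
Qed.

Lemma tends_uniq s f g : tends s f -> tends s g -> f = g.
Proof.
move=> sf sg; apply: fpsP => n.
have [M HM] := sf n.+1; have [K HK] := sg n.+1.
by rewrite -(HM (maxn M K)) ?leq_maxl // -(HK (maxn M K)) ?leq_maxr.
Qed.

Lemma tends_sub (u : nat -> nat) s f :
  (forall n, (n <= u n)%N) -> tends s f -> tends (fun n => s (u n)) f.
Proof.
move=> un sf N; have [M HM] := sf N; exists M => m Mm.
exact/HM/(leq_trans Mm).
Qed.

Lemma tendsD s t f g :
  tends s f -> tends t g -> tends (fun n => s n + t n) (f + g).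
Proof.
move=> sf tg N; have [M HM] := sf N; have [K HK] := tg N.
exists (maxn M K) => m; rewrite geq_max => /andP[Mm Km].
by apply: eqmD; [apply: HM | apply: HK].
Qed.

Lemma tendsM s t f g :
  tends s f -> tends t g -> tends (fun n => s n * t n) (f * g).
Proof.
move=> sf tg N; have [M HM] := sf N; have [K HK] := tg N.
exists (maxn M K) => m; rewrite geq_max => /andP[Mm Km].
by apply: eqmM; [apply: HM | apply: HK].
Qed.

Lemma tendsN s f : tends s f -> tends (fun n => - s n) (- f).
Proof.
by move=> sf N; have [M HM] := sf N; exists M => m /HM; apply: eqmN.
Qed.

Lemma tendsB s t f g :
  tends s f -> tends t g -> tends (fun n => s n - t n) (f - g).
Proof. by move=> sf /tendsN; apply: tendsD. Qed.

Lemma tendsX s f k : tends s f -> tends (fun n => s n ^+ k) (f ^+ k).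
Proof.
by move=> sf N; have [M HM] := sf N; exists M => m /HM; apply: eqmX.
Qed.

Lemma eqm_tends s f : (forall n, eqm n (s n) f) -> tends s f.
Proof. by move=> sf N; exists N => m Nm; exact: eqm_le Nm (sf m). Qed.

Definition prodn s n := \prod_(i < n) s i.

Lemma prodnS s n : prodn s n.+1 = prodn s n * s n.
Proof. by rewrite /prodn big_ord_recr. Qed.

Lemma prodnM s t n : prodn (fun i => s i * t i) n = prodn s n * prodn t n.
Proof. by rewrite /prodn big_split. Qed.

Lemma eq_prodn s t n : s =1 t -> prodn s n = prodn t n.
Proof. by move=> st; apply: eq_bigr => i _. Qed.

Lemma prodn2 s n :
  prodn s (2 * n) = prodn (fun i => s (2 * i)%N * s (2 * i).+1) n.
Proof.
elim: n => [|n IH]; first by rewrite /prodn !big_ord0.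
by rewrite [RHS]prodnS -IH mulnS !prodnS -mulrA.
Qed.

Lemma prodn3 s n :
  prodn s (3 * n) =
  prodn (fun i => s (3 * i)%N * s (3 * i).+1 * s (3 * i).+2) n.
Proof.
elim: n => [|n IH]; first by rewrite /prodn !big_ord0.
by rewrite [RHS]prodnS -IH mulnS !prodnS -!mulrA.
Qed.

Definition iprod s := diag (prodn s).

Lemma eqm_iprod s :
  (forall n, eqm n.+1 (s n) 1) -> forall n, eqm n.+1 (prodn s n) (iprod s).
Proof.
move=> s1; apply: eqm_diag => n.
by rewrite prodnS -[X in eqm _ _ X]mulr1; apply: eqmM.
Qed.

Lemma tends_iprod s : (forall n, eqm n.+1 (s n) 1) -> tends (prodn s) (iprod s).
Proof.
by move=> s1; apply: eqm_tends => n; exact: (eqm_le (leqnSn n) (@eqm_iprod s s1 n)).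
Qed.

(* [V f] is the series f(q^3). *)
Definition V f : fps R := Fps (fun n => if (3 %| n)%N then f (n %/ 3)%N else 0).

(** [res3 0] is the operator U; [r = 0, 1, 2] give the components used in [dissect]. *)
Definition res3 r f : fps R := Fps (fun n => f (3 * n + r)%N).

Lemma coef_trunc_comp N f i : (i < N)%N -> V f i = (trunc N f \Po 'X^3)`_i.
Proof.
move=> iN; rewrite coef_comp_poly_Xn //=; case: ifP => // d3.
by rewrite -coef_trunc // ltn_divLR // (leq_trans iN) // leq_pmulr.
Qed.

Lemma V_is_zmod_morphism : zmod_morphism V.
Proof.
move=> f g; apply: fpsP => n; rewrite fcoefB /=.
by case: ifP; rewrite // subr0.
Qed.

Lemma V_is_monoid_morphism : monoid_morphism V.
Proof.
split=> [|f g]; apply: fpsP => n.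
  by rewrite /= !coefC; case: n => // n; case: ifP => //; case: eqP => //; lia.
have H := @coef_trunc_comp n.+1.
rewrite [RHS](fps_mul_poly (H f) (H g)) // -comp_polyM !coef_comp_poly_Xn //=.
case: ifP => // d3; rewrite -(@fps_mul_poly _ n.+1 _ _ f g) //.
- by move=> i iN; rewrite -coef_trunc.
- by move=> i iN; rewrite -coef_trunc.
- by rewrite ltnS leq_div.
Qed.

HB.instance Definition _ :=
  GRing.isZmodMorphism.Build (fps R) (fps R) V V_is_zmod_morphism.
HB.instance Definition _ :=
  GRing.isMonoidMorphism.Build (fps R) (fps R) V V_is_monoid_morphism.

Lemma Vq : V q = q ^+ 3.
Proof.
apply: fpsP => n; rewrite fcoef_qn /= coefX; case: ifP => d3.
  by congr (_%:R); lia.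
by case: eqP => // n3; rewrite n3 in d3.
Qed.

Lemma Vqn k : V (q ^+ k) = q ^+ (3 * k).
Proof. by rewrite rmorphXn /= Vq -exprM. Qed.

Lemma V0 f : V f 0 = f 0. Proof. by []. Qed.

Lemma eqmV N f g : eqm N f g -> eqm N (V f) (V g).
Proof.
move=> fg i iN /=; case: ifP => // d3; apply: fg; apply: leq_ltn_trans iN.
exact: leq_div.
Qed.

Lemma tendsV s f : tends s f -> tends (fun n => V (s n)) (V f).
Proof.
by move=> sf N; have [M HM] := sf N; exists M => m /HM; apply: eqmV.
Qed.

Lemma V_prodn s n : V (prodn s n) = prodn (fun i => V (s i)) n.
Proof. exact: rmorph_prod. Qed.

Lemma VE f n r : (r < 3)%N -> V f (3 * n + r)%N = if r == 0 then f n else 0.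
Proof.
move=> r3 /=; case: eqP => [->|r0]; first by rewrite addn0 dvdn_mulr ?mulKn.
by rewrite ifF //; lia.
Qed.

Lemma res3_dissect a b c :
  let f := V a + q * V b + q ^+ 2 * V c in
  (res3 0 f = a) * (res3 1 f = b) * (res3 2 f = c).
Proof.
move=> f; have H n : f n = V a n + (if (n < 1)%N then 0 else V b (n - 1)%N)
    + (if (n < 2)%N then 0 else V c (n - 2)%N).
  by rewrite /f !fcoefD -!fcoef_qnM expr1.
have K n r : (r < 3)%N -> f (3 * n + r)%N =
    if r == 0 then a n else if r == 1%N then b n else c n.
  move=> r3; rewrite H VE //; case: r r3 => [|[|[|//]]] _.
  - case: n => [|n]; first by rewrite !addr0.
    have -> : (3 * n.+1 + 0 - 1 = 3 * n + 2)%N by lia.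
    have -> : (3 * n.+1 + 0 - 2 = 3 * n + 1)%N by lia.
    by rewrite !VE // !if_same !addr0.
  - rewrite ifF; last lia.
    rewrite addnK -[X in V b X]addn0 VE // eqxx.
    case: n => [|n]; first by rewrite addr0 add0r.
    have -> : (3 * n.+1 + 1 - 2 = 3 * n + 2)%N by lia.
    by rewrite VE // if_same addr0 add0r.
  - rewrite !ifF; try lia.
    rewrite addnK -[X in V c X]addn0 VE // eqxx.
    have -> : (3 * n + 2 - 1 = 3 * n + 1)%N by lia.
    by rewrite VE // !add0r.
by split; first split; apply: fpsP => n; rewrite [LHS]K.
Qed.

Lemma dissect f : f = V (res3 0 f) + q * V (res3 1 f) + q ^+ 2 * V (res3 2 f).
Proof.
set g := RHS; have [[g0 g1] g2] := res3_dissect (res3 0 f) (res3 1 f) (res3 2 f).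
apply: fpsP => n; rewrite (divn_eq n 3) mulnC.
have: (n %% 3 < 3)%N by rewrite ltn_mod.
case: (n %% 3)%N => [|[|[|//]]] _.
- by have := congr1 (fun h : fps R => h (n %/ 3)%N) g0.
- by have := congr1 (fun h : fps R => h (n %/ 3)%N) g1.
- by have := congr1 (fun h : fps R => h (n %/ 3)%N) g2.
Qed.

Lemma res3_is_zmod_morphism r : zmod_morphism (res3 r).
Proof. by move=> f g; apply: fpsP. Qed.

HB.instance Definition _ r :=
  GRing.isZmodMorphism.Build (fps R) (fps R) (res3 r) (res3_is_zmod_morphism r).

Lemma res3_VM f g : res3 0 (V f * g) = f * res3 0 g.
Proof.
rewrite [in LHS](dissect g).
have -> : V f * (V (res3 0 g) + q * V (res3 1 g) + q ^+ 2 * V (res3 2 g)) =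
    V (f * res3 0 g) + q * V (f * res3 1 g) + q ^+ 2 * V (f * res3 2 g).
  by rewrite !rmorphM /=; ring.
by rewrite res3_dissect.
Qed.

Lemma res3_V f : res3 0 (V f) = f.
Proof. by apply: fpsP => n /=; rewrite addn0 dvdn_mulr // mulKn. Qed.

Lemma tends_res3 r s f : tends s f -> tends (fun n => res3 r (s n)) (res3 r f).
Proof.
move=> sf N; have [M HM] := sf (3 * N + r)%N; exists M => m /HM H i iN /=.
by apply: H; lia.
Qed.

(* With w a primitive cube root of unity, f(q) f(wq) f(w^2 q) = (nrm f)(q^3). *)
Definition nrm f := res3 0 f ^+ 3 + q * res3 1 f ^+ 3 + q ^+ 2 * res3 2 f ^+ 3
  - q * res3 0 f * res3 1 f * res3 2 f *+ 3.

Lemma nrm_dissect a b c : nrm (V a + q * V b + q ^+ 2 * V c) =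
  a ^+ 3 + q * b ^+ 3 + q ^+ 2 * c ^+ 3 - q * a * b * c *+ 3.
Proof. by rewrite /nrm !res3_dissect. Qed.

(** If x^3 = q, then [nrm] is the norm of a + bx + cx^2 over the base. The components of the product
    are those of the polynomial product reduced by x^3 = q. *)
Lemma nrmM f g : nrm (f * g) = nrm f * nrm g.
Proof.
have -> : f * g =
   V (res3 0 f * res3 0 g + q * (res3 1 f * res3 2 g + res3 2 f * res3 1 g))
   + q * V (res3 0 f * res3 1 g + res3 1 f * res3 0 g + q * (res3 2 f * res3 2 g))
   + q ^+ 2 * V (res3 0 f * res3 2 g + res3 1 f * res3 1 g + res3 2 f * res3 0 g).
  rewrite {1}(dissect f) {1}(dissect g) !rmorphD /= !rmorphM /= !rmorphD /=.
  by rewrite !rmorphM /= Vq; ring.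
by rewrite nrm_dissect /nrm; ring.
Qed.

Lemma tends_nrm s f : tends s f -> tends (fun n => nrm (s n)) (nrm f).
Proof.
move=> sf; have H r := tends_res3 r sf.
apply: tendsB.
  apply: tendsD; first apply: tendsD; [exact: tendsX| |].
    by apply: tendsM (tendsX _ _) => //; apply: tends_cst.
  by apply: tendsM (tendsX _ _) => //; apply: tends_cst.
have K : tends (fun n => q * res3 0 (s n) * res3 1 (s n) * res3 2 (s n) * 3%:R)
   (q * res3 0 f * res3 1 f * res3 2 f * 3%:R).
  by do !apply: tendsM => //; apply: tends_cst.
by rewrite -mulr_natr; apply: eq_tends K => n; rewrite mulr_natr.
Qed.

Lemma nrm_prodn s n : nrm (prodn s n) = prodn (fun i => nrm (s i)) n.
Proof.
elim: n => [|n IH]; last by rewrite !prodnS nrmM IH.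
rewrite /prodn !big_ord0.
have -> : (1 : fps R) = V 1 + q * V 0 + q ^+ 2 * V 0.
  by rewrite rmorph1 !rmorph0; ring.
by rewrite nrm_dissect; ring.
Qed.

(** A factor in q^3 equals each of its conjugates, so its norm is a cube. For n prime to 3 the
    conjugates 1 - w^j q^n multiply to 1 - q^(3n), the image of 1 - q^n under [V]. *)
Lemma nrm_1subq m :
  (nrm (1 - q ^+ (3 * m)) = (1 - q ^+ m) ^+ 3) *
  (nrm (1 - q ^+ (3 * m).+1) = 1 - q ^+ (3 * m).+1) *
  (nrm (1 - q ^+ (3 * m).+2) = 1 - q ^+ (3 * m).+2).
Proof.
have q3 : q ^+ (3 * m) = (q ^+ m) ^+ 3 by rewrite mulnC exprM.
split; first split.
- have -> : 1 - q ^+ (3 * m) = V (1 - q ^+ m) + q * V 0 + q ^+ 2 * V 0.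
    by rewrite rmorphB rmorph1 rmorph0 /= Vqn; ring.
  by rewrite nrm_dissect; ring.
- have {1}-> : 1 - q ^+ (3 * m).+1 = V 1 + q * V (- q ^+ m) + q ^+ 2 * V 0.
    by rewrite rmorphN rmorph1 rmorph0 /= Vqn exprS; ring.
  by rewrite nrm_dissect (exprS q (3 * m)) q3; ring.
- have {1}-> : 1 - q ^+ (3 * m).+2 = V 1 + q * V 0 + q ^+ 2 * V (- q ^+ m).
    by rewrite rmorphN rmorph1 rmorph0 /= Vqn !exprS; ring.
  by rewrite nrm_dissect (exprS q (3 * m).+1) (exprS q (3 * m)) q3; ring.
Qed.

End Limits.

(** * The Jacobi triple product *)

Section FiniteTripleProduct.
Variables (R : comNzRingType) (p : R).

(** Gaussian binomial in base [p], given by a Pascal rule because the usual quotient of products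
    makes no sense in a general ring. *)
Fixpoint gbin (n k : nat) : R :=
  match n, k with
  | _, 0 => 1
  | 0, _.+1 => 0
  | n'.+1, k'.+1 => gbin n' k' + p ^+ k'.+1 * gbin n' k'.+1
  end.

Lemma gbin0 n : gbin n 0 = 1. Proof. by case: n. Qed.

Lemma gbinS n k : gbin n.+1 k.+1 = gbin n k + p ^+ k.+1 * gbin n k.+1.
Proof. by []. Qed.

Lemma gbin_small n k : (n < k)%N -> gbin n k = 0.
Proof.
elim: n k => [|n IH] [|k] //; rewrite ltnS => nk.
by rewrite gbinS !IH ?mulr0 ?addr0 // ltnW.
Qed.

Lemma gbinS_sym n k : (k <= n)%N ->
  gbin n.+1 k.+1 = p ^+ (n - k) * gbin n k + gbin n k.+1.
Proof.
elim: n k => [|n IH] k kn.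
  by move: kn; rewrite leqn0 => /eqP -> /=; ring.
rewrite gbinS; case: k kn => [|k] kn.
  by rewrite [in LHS]IH // [in RHS]gbinS !gbin0 !subn0 (exprS p n); ring.
rewrite ltnS in kn; rewrite subSS.
have [kn'|kn'] := ltnP k n; last first.
  have -> : k = n by apply/eqP; rewrite eqn_leq kn kn'.
  by rewrite subnn !(@gbin_small n.+1 n.+2) //; ring.
rewrite [in LHS]IH // [in LHS](IH k.+1) // [in RHS]gbinS [gbin n.+1 k.+2]gbinS.
have -> : (n - k)%N = (n - k.+1).+1 by lia.
by rewrite !exprS; ring.
Qed.

Lemma sum_gbinS N (E : nat -> R) :
  \sum_(i < N.+2) gbin N.+1 i * E i =
  \sum_(i < N.+1) gbin N i * (p ^+ i * E i + E i.+1).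
Proof.
have H : \sum_(i < N.+2) gbin N i * (p ^+ i * E i) =
    \sum_(i < N.+1) gbin N i * (p ^+ i * E i).
  by rewrite big_ord_recr /= gbin_small // mul0r addr0.
under [RHS]eq_bigr do rewrite mulrDr.
rewrite [RHS]big_split /= -H big_ord_recl [X in _ = X + _]big_ord_recl /= !gbin0.
rewrite !mul1r -addrA -big_split /=; congr (_ + _).
by apply: eq_bigr => i _; rewrite /bump /= add1n; ring.
Qed.

Lemma sum_gbinS_sym N (E : nat -> R) :
  \sum_(i < N.+2) gbin N.+1 i * E i =
  \sum_(i < N.+1) gbin N i * (E i + p ^+ (N - i) * E i.+1).
Proof.
have H : \sum_(i < N.+2) gbin N i * E i = \sum_(i < N.+1) gbin N i * E i.
  by rewrite big_ord_recr /= gbin_small // mul0r addr0.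
under [RHS]eq_bigr do rewrite mulrDr.
rewrite [RHS]big_split /= -H big_ord_recl [X in _ = X + _]big_ord_recl /= !gbin0.
rewrite ?mul1r -addrA -big_split /=; congr (_ + _).
apply: eq_bigr => i _; rewrite /bump /= !add0n !add1n -gbinS.
rewrite gbinS_sym; last exact: ltnSE (ltn_ord i).
ring.
Qed.

Definition poch n := \prod_(i < n) (1 - p ^+ i.+1).

Lemma pochS n : poch n.+1 = poch n * (1 - p ^+ n.+1).
Proof. by rewrite /poch big_ord_recr. Qed.

Lemma gbin_poch n k : (k <= n)%N -> gbin n k * (poch k * poch (n - k)) = poch n.
Proof.
elim: n k => [|n IH] [|k] //.
- by move=> _; rewrite /poch subn0 big_ord0 !mul1r.
- by move=> _; rewrite /poch subn0 big_ord0 gbin0 !mul1r.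
rewrite ltnS => kn; rewrite subSS gbinS mulrDl.
have -> : gbin n k * (poch k.+1 * poch (n - k)) = (1 - p ^+ k.+1) * poch n.
  by rewrite -(IH k) // pochS; ring.
have -> : p ^+ k.+1 * gbin n k.+1 * (poch k.+1 * poch (n - k)) =
    p ^+ k.+1 * (1 - p ^+ (n - k)) * poch n.
  have [kn'|kn'] := ltnP k n; last first.
    have -> : k = n by apply/eqP; rewrite eqn_leq kn kn'.
    by rewrite gbin_small // subnn expr0; ring.
  by rewrite -(IH k.+1) // -(@subnSK k n) // (pochS (n - k.+1)); ring.
rewrite pochS -mulrDl mulrC mulrBr mulr1 -exprD addSn subnKC //; ring.
Qed.

End FiniteTripleProduct.

#[local] Arguments gbin : simpl never.

Section Theta.
Variable R : comNzRingType.
Implicit Types a b : R.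

(* [theta a b k] = a^(k(k+1)/2) b^(k(k-1)/2), Ramanujan's general theta term. *)
Definition theta a b (k : int) : R :=
  match k with
  | Posz n => a ^+ 'C(n.+1, 2) * b ^+ 'C(n, 2)
  | Negz n => a ^+ 'C(n.+1, 2) * b ^+ 'C(n.+2, 2)
  end.

Lemma theta0 a b : theta a b 0 = 1.
Proof. by rewrite -[0]/(Posz 0) /theta !(@bin_small _ 2) // mul1r. Qed.

Lemma thetaN a b k : theta b a (- k) = theta a b k.
Proof.
by case: k => [[|n]|n]; rewrite ?NegzE ?opprK /theta /= ?binn 1?mulrC.
Qed.

Lemma theta_shift a b (n m : nat) (k : int) : n%:Z - k = m%:Z ->
  a * (a * b) ^+ n * theta a b k = (a * b) ^+ m * theta a b (k + 1).
Proof.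
case: k => [k|k] nkm.
  have -> : n = (k + m)%N by lia.
  have -> : (Posz k + 1 = Posz k.+1) by lia.
  rewrite /theta (binS k.+1 1) (binS k 1) !bin1 !exprD (exprS a k) !exprMn.
  ring.
have -> : m = (n + k.+1)%N by lia.
have -> : theta a b (Negz k + 1) = a ^+ 'C(k, 2) * b ^+ 'C(k.+1, 2).
  case: k {nkm} => [|k]; first by rewrite /theta.
  by have -> : Negz k.+1 + 1 = Negz k by lia.
rewrite /theta (binS k.+1 1) (binS k 1) !bin1 !exprD (exprS b k) !exprMn.
rewrite (exprS a k) (exprS b k); ring.
Qed.

Lemma theta_shiftN a b (n m : nat) (k : int) : n%:Z + k = m%:Z ->
  b * (a * b) ^+ n * theta a b k = (a * b) ^+ m * theta a b (k - 1).
Proof.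
move=> nkm; rewrite -(thetaN a b k) -(thetaN a b (k - 1)) (mulrC a b).
rewrite (@theta_shift b a n m) ?opprK //; congr (_ * theta _ _ _); lia.
Qed.

(** The two new factors are absorbed one at a time, raising the upper index from 2n to 2n + 1 to 2n
    + 2: the factor with [a] by one Pascal rule, the factor with [b] by the other. *)
Lemma finite_triple_product a b n :
  \prod_(s < n) ((1 + a * (a * b) ^+ s) * (1 + b * (a * b) ^+ s)) =
  \sum_(i < (2 * n).+1) gbin (a * b) (2 * n) i * theta a b (i%:Z - n%:Z).
Proof.
elim: n => [|n IH]; first by rewrite big_ord0 big_ord1 theta0 mulr1.
rewrite big_ord_recr /= IH mulrA [X in X * _]mulrDr mulr1 [X in _ + X]big_distrl.
rewrite -big_split /=.
have -> : (2 * n.+1 = (2 * n).+2)%N by lia.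
rewrite [RHS](sum_gbinS (a * b) (2 * n).+1 (fun i => theta a b (i%:Z - n.+1%:Z))).
have -> : \sum_(i < (2 * n).+1)
    (gbin (a * b) (2 * n) i * theta a b (i%:Z - n%:Z) +
     gbin (a * b) (2 * n) i * theta a b (i%:Z - n%:Z) * (a * (a * b) ^+ n)) =
    \sum_(i < (2 * n).+2) gbin (a * b) (2 * n).+1 i * theta a b (i%:Z - n%:Z).
  rewrite [RHS](sum_gbinS_sym (a * b) (2 * n) (fun i => theta a b (i%:Z - n%:Z))).
  apply: eq_bigr => i _.
  rewrite -mulrA [theta _ _ _ * _]mulrC (@theta_shift a b n (2 * n - i)).
    by rewrite -mulrDr; congr (_ * (_ + _ * theta _ _ _)); lia.
  have := ltn_ord i; lia.
rewrite big_distrl; apply: eq_bigr => i _ /=.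
rewrite -mulrA; congr (_ * _); rewrite mulrDr mulr1 mulrC.
rewrite (@theta_shiftN a b n i); last lia.
rewrite addrC; congr (_ * theta _ _ _ + theta _ _ _); lia.
Qed.

End Theta.

Section BilateralSums.
Variable W : nmodType.
Implicit Type e : int -> W.

Definition bsum e n := \sum_(i < (2 * n).+1) e (i%:Z - n%:Z).

Lemma bsum0 e : bsum e 0 = e 0.
Proof. by rewrite /bsum big_ord1. Qed.

Lemma bsumS e n : bsum e n.+1 = e (- n.+1%:Z) + bsum e n + e n.+1%:Z.
Proof.
rewrite /bsum; have -> : (2 * n.+1 = (2 * n).+2)%N by lia.
rewrite big_ord_recr big_ord_recl /=; congr (_ + _ + _).
- by congr e; lia.
- by apply: eq_bigr => i _; rewrite /bump /=; congr e; lia.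
- by congr e; lia.
Qed.

Lemma bsumD e e' n : bsum (fun k => e k + e' k) n = bsum e n + bsum e' n.
Proof. exact: big_split. Qed.

Lemma eq_bsum e e' n : e =1 e' -> bsum e n = bsum e' n.
Proof. by move=> ee; apply: eq_bigr. Qed.

Lemma bsumN e n : bsum (fun k => e (- k)) n = bsum e n.
Proof.
elim: n => [|n IH]; first by rewrite !bsum0 oppr0.
by rewrite !bsumS IH opprK addrC addrA addrAC.
Qed.

(** The range from -(3n + 1) to 3n + 1 has 3(2n + 1) terms, hence splits exactly into blocks centred
    at multiples of 3. *)
Lemma bsum3 e n : bsum e (3 * n).+1 =
  bsum (fun k => e (3 * k - 1) + e (3 * k) + e (3 * k + 1)) n.
Proof.
elim: n => [|n IH]; first by rewrite bsumS !bsum0.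
have -> : ((3 * n.+1).+1 = (3 * n).+4)%N by lia.
rewrite [RHS]bsumS -IH 3!(bsumS e).
rewrite !addrA; congr (_ + _ + _ + _); last 3 first.
- by congr e; lia.
- by congr e; lia.
- by congr e; lia.
congr (_ + _); congr (_ + _ + _); congr e; lia.
Qed.

End BilateralSums.

Section TripleProduct.
Variable R : comNzRingType.
Implicit Types (a b p : fps R).
Local Notation q := (q R).

Lemma eqmX0 N p : eqm 1 p 0 -> eqm N (p ^+ N) 0.
Proof.
by move=> p0; elim: N => // N IH; rewrite exprS; apply: (@eqm0M _ 1).
Qed.

Definition pochinf p := iprod (fun n => 1 - p ^+ n.+1).

Lemma eqm_poch p n : eqm 1 p 0 -> eqm n.+1 (poch p n) (pochinf p).
Proof.
move=> p0; apply: eqm_iprod => m; rewrite -[X in eqm _ _ X]subr0.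
exact/eqmB/eqmX0.
Qed.

(** In (p)_N / ((p)_i (p)_(N-i)) all three indices are at least m, so each product agrees with
    [pochinf p] to the stated order. *)
Lemma eqm_gbin p N i m : eqm 1 p 0 -> (m + i <= N)%N -> (m <= i)%N ->
  eqm m.+1 (gbin p N i * pochinf p) 1.
Proof.
move=> p0 miN mi.
have H j : (m <= j)%N -> eqm m.+1 (poch p j) (pochinf p).
  move=> mj; have mj1 : (m.+1 <= j.+1)%N by [].
  exact: (eqm_le mj1 (@eqm_poch p j p0)).
have p1 j : poch p j 0 = 1.
  have /(_ 0%N) -> // := @eqm_poch p j p0.
  by rewrite /pochinf /iprod /= /prodn big_ord0 fcoef1_0.
set w := poch p i * poch p (N - i).
have w1 : w 0 = 1 by rewrite fcoefM0 !p1 mul1r.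
have gw : gbin p N i * w = poch p N by apply: gbin_poch; lia.
have e1 : eqm m.+1 (gbin p N i * pochinf p * w) w.
  rewrite mulrAC gw; apply: (@eqm_trans _ _ (pochinf p * pochinf p)).
    by apply: eqmM => //; apply: H; lia.
  by apply/eqm_sym/eqmM; apply: H; lia.
have := eqmM e1 (@eqm_refl _ m.+1 (fps_inv w)).
by rewrite -[_ * w * _]mulrA mul_fps_inv // mulr1.
Qed.

(** Both binomial exponents are at least |k| - 1, so (ab)^(|k| - 1) divides the term. *)
Lemma eqm_theta a b k : eqm 1 (a * b) 0 -> eqm `|k|.-1 (theta a b k) 0.
Proof.
move=> ab0.
have H n x y : (n <= x)%N -> (n <= y)%N -> eqm n (a ^+ x * b ^+ y) 0.
  move=> /subnKC <- /subnKC <-; rewrite !exprD mulrACA -exprMn.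
  set z := a ^+ _ * _; rewrite -[X in eqm _ _ X](mul0r z).
  by apply: eqmM => //; exact: eqmX0.
case: k => [[|n]|n] //=; rewrite /theta; apply: H.
- by rewrite !binS !bin1; lia.
- by rewrite binS bin1; lia.
- by rewrite binS bin1; lia.
- by rewrite !binS !bin1; lia.
Qed.

(** The product is any limit [P] rather than an [iprod], so that a = 1 is allowed: there the factor
    at s = 0 is not close to 1. *)
Theorem triple_product a b P : eqm 1 (a * b) 0 ->
  tends (prodn (fun s => (1 + a * (a * b) ^+ s) * (1 + b * (a * b) ^+ s))) P ->
  tends (bsum (theta a b)) (P * pochinf (a * b)).
Proof.
move=> ab0 tP; set Q := pochinf _.
have tPQ := tendsM tP (tends_cst Q).
suff H : tends (fun n => prodn (fun s => (1 + a * (a * b) ^+ s) *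
   (1 + b * (a * b) ^+ s)) n * Q - bsum (theta a b) n) 0.
  rewrite -[P * Q]subr0; apply: eq_tends (tendsB tPQ H) => n /=.
  by rewrite opprB addrC subrK.
apply: eqm_tends => n.
rewrite /prodn finite_triple_product /bsum big_distrl -sumrB /=.
apply: (big_ind (fun x => eqm n x 0)) => //.
  by move=> x y x0 y0; rewrite -[0]addr0; apply: eqmD.
move=> i _; set g := gbin _ _ _; set k := i%:Z - n%:Z.
have -> : g * theta a b k * Q - theta a b k = (g * Q - 1) * theta a b k by ring.
have ii := ltn_ord i.
(* The binomial is inaccurate only near the ends of the range, where the theta term is small: min(i,
   2n - i) = n - |k|, so the two orders add up to at least n. *)
have kn : (n <= (minn i (2 * n - i)).+1 + `|k|.-1)%N by rewrite /k; lia.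
apply: (eqm_le kn); apply: eqm0M; last exact: eqm_theta.
by apply: (proj1 (@eqmP _ _ _ _)); apply: eqm_gbin => //; lia.
Qed.

End TripleProduct.

(** * Infinite products *)

Section InfiniteProducts.
Variable R : comNzRingType.
Implicit Types s t : nat -> fps R.
Local Notation q := (q R).

Definition near1 s := forall n, eqm n.+1 (s n) 1.

Lemma near1M s t : near1 s -> near1 t -> near1 (fun i => s i * t i).
Proof. by move=> s1 t1 n; rewrite -[X in eqm _ _ X]mulr1; apply: eqmM. Qed.

Lemma near1_sub (u : nat -> nat) s :
  (forall n, (n <= u n)%N) -> near1 s -> near1 (fun i => s (u i)).
Proof.
move=> un s1 n; have nu : (n.+1 <= (u n).+1)%N by rewrite ltnS.
exact: (eqm_le nu (s1 (u n))).
Qed.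

Lemma near1V s : near1 s -> near1 (fun i => V (s i)).
Proof.
move=> s1 n; have V1 : V 1 = 1 :> fps R by apply: rmorph1.
by rewrite -V1; apply: eqmV.
Qed.

Lemma near1_subq (u : nat -> nat) :
  (forall n, (n < u n)%N) -> near1 (fun i => 1 - q ^+ u i).
Proof.
move=> un n; rewrite -[X in eqm _ _ X]subr0; apply: eqmB => //.
by rewrite -[q ^+ _]mulr1; apply: eqm_qn.
Qed.

Lemma near1_addq (u : nat -> nat) :
  (forall n, (n < u n)%N) -> near1 (fun i => 1 + q ^+ u i).
Proof.
move=> un n; rewrite -[X in eqm _ _ X]addr0; apply: eqmD => //.
by rewrite -[q ^+ _]mulr1; apply: eqm_qn.
Qed.

Lemma eq_iprod s t : s =1 t -> iprod s = iprod t.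
Proof. by move=> st; apply: fpsP => n /=; rewrite (eq_prodn _ st). Qed.

Lemma iprod0 s : iprod s 0 = 1.
Proof. by rewrite /iprod /= /prodn big_ord0 fcoef1_0. Qed.

Lemma iprodM s t : near1 s -> near1 t ->
  iprod (fun i => s i * t i) = iprod s * iprod t.
Proof.
move=> s1 t1; apply: tends_uniq (tends_iprod (near1M s1 t1)) _.
apply: eq_tends (tendsM (tends_iprod s1) (tends_iprod t1)) => n.
by rewrite -prodnM.
Qed.

Lemma iprod2 s : near1 s -> iprod (fun i => s (2 * i)%N * s (2 * i).+1) = iprod s.
Proof.
move=> s1; have t1 : near1 (fun i => s (2 * i)%N * s (2 * i).+1).
  apply: near1M; first apply: (@near1_sub (fun i => 2 * i)%N) => // n; first lia.
  by apply: (@near1_sub (fun i => (2 * i).+1)%N) => // m; lia.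
apply: tends_uniq (tends_iprod t1) _.
apply: (@eq_tends _ (fun n => prodn s (2 * n))) => [n|]; first exact: prodn2.
by apply: (@tends_sub _ (fun n => 2 * n)%N (prodn s)); [lia|exact: tends_iprod].
Qed.

Lemma iprod3 s : near1 s ->
  iprod (fun i => s (3 * i)%N * s (3 * i).+1 * s (3 * i).+2) = iprod s.
Proof.
move=> s1.
have t1 : near1 (fun i => s (3 * i)%N * s (3 * i).+1 * s (3 * i).+2).
  apply: near1M; first apply: near1M.
  - by apply: (@near1_sub (fun i => 3 * i)%N) => // n; lia.
  - by apply: (@near1_sub (fun i => (3 * i).+1)%N) => // n; lia.
  - by apply: (@near1_sub (fun i => (3 * i).+2)%N) => // n; lia.
apply: tends_uniq (tends_iprod t1) _.
apply: (@eq_tends _ (fun n => prodn s (3 * n))) => [n|]; first exact: prodn3.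
by apply: (@tends_sub _ (fun n => 3 * n)%N (prodn s)); [lia|exact: tends_iprod].
Qed.

Lemma V_iprod s : near1 s -> V (iprod s) = iprod (fun i => V (s i)).
Proof.
move=> s1; apply: tends_uniq (tends_iprod (near1V s1)).
by apply: eq_tends (tendsV (tends_iprod s1)) => n; rewrite V_prodn.
Qed.

Lemma nrm_iprod s : near1 s -> tends (prodn (fun i => nrm (s i))) (nrm (iprod s)).
Proof.
by move=> s1; apply: eq_tends (tends_nrm (tends_iprod s1)) => n; exact: nrm_prodn.
Qed.

End InfiniteProducts.

(* Locking keeps [ring] from comparing distinct infinite products by unfolding
   them. *)
(* [euler R k] is the series f_k. *)
HB.lock Definition euler (R : comNzRingType) k :=
  iprod (fun i => 1 - q R ^+ (k * i.+1)).
HB.lock Definition qodd (R : comNzRingType) :=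
  iprod (fun i => 1 - q R ^+ (2 * i).+1).
HB.lock Definition qneg (R : comNzRingType) :=
  iprod (fun i => 1 + q R ^+ i.+1).
(** The factors of [qneg] whose exponent is prime to 3; [qodd15] is the same selection from
    [qodd]. *)
HB.lock Definition qneg12 (R : comNzRingType) :=
  iprod (fun i => (1 + q R ^+ (3 * i).+1) * (1 + q R ^+ (3 * i).+2)).
HB.lock Definition qodd15 (R : comNzRingType) :=
  iprod (fun i => (1 - q R ^+ (6 * i).+1) * (1 - q R ^+ (6 * i + 5))).

Section EulerProducts.
Variable R : comNzRingType.
Local Notation q := (q R).
Local Notation euler := (euler R).
Local Notation qodd := (qodd R).
Local Notation qneg := (qneg R).
Local Notation qneg12 := (qneg12 R).
Local Notation qodd15 := (qodd15 R).

Lemma euler_near1 k : (0 < k)%N -> near1 (fun i => 1 - q ^+ (k * i.+1)).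
Proof. by move=> k0; apply: near1_subq => n; rewrite leq_pmull. Qed.

Lemma euler0 k : euler k 0 = 1. Proof. by rewrite euler.unlock iprod0. Qed.

Lemma V_euler k : (0 < k)%N -> V (euler k) = euler (3 * k).
Proof.
move=> k0; rewrite euler.unlock V_iprod; last exact: euler_near1.
by apply: eq_iprod => i; rewrite rmorphB rmorph1 /= Vqn mulnA.
Qed.

Lemma pochinf_euler k : pochinf (q ^+ k) = euler k.
Proof. by rewrite euler.unlock; apply: eq_iprod => i; rewrite -exprM. Qed.

Lemma nrm_1subq_ndvd m : ~~ (3 %| m)%N -> nrm (1 - q ^+ m) = 1 - q ^+ m.
Proof.
rewrite /dvdn (divn_eq m 3) mulnC.
have: (m %% 3 < 3)%N by rewrite ltn_mod.
case: (m %% 3)%N => [|[|[|//]]] _; first by rewrite addn0 modnMr.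
  by rewrite addn1 nrm_1subq.
by rewrite addn2 nrm_1subq.
Qed.

(** Every third factor of f_k has as norm the cube of a factor of f_k, and these make up f_k^3; the
    others are fixed by the norm and make up f_k / f_(3k). Hence 3n factors of the norm are matched
    with 3n factors of f_k and n cubed ones. *)
Lemma nrm_euler k : (0 < k)%N -> ~~ (3 %| k)%N ->
  nrm (euler k) * euler (3 * k) = euler k ^+ 4.
Proof.
rewrite euler.unlock => k0 k3; have k30 : (0 < 3 * k)%N by lia.
have t1 := tends_iprod (euler_near1 k0); have t3 := tends_iprod (euler_near1 k30).
have le3 n : (n <= 3 * n)%N by lia.
apply: tends_uniq (tendsM (tends_sub le3 (nrm_iprod (euler_near1 k0))) t3) _.
apply: eq_tends (tendsM (tends_sub le3 t1) (tendsX 3 t1)) => n /=.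
have prodnX u m : prodn u n ^+ m = prodn (fun i => u i ^+ m) n :> fps R.
  by rewrite /prodn -prodrXl.
rewrite !prodn3 prodnX -!prodnM; apply: eq_prodn => i.
have -> : (k * (3 * i).+3 = 3 * (k * i.+1))%N by lia.
have -> : (3 * k * i.+1 = 3 * (k * i.+1))%N by lia.
have n3 j : ~~ (3 %| j)%N -> nrm (1 - q ^+ (k * j)) = 1 - q ^+ (k * j).
  by move=> j3; rewrite nrm_1subq_ndvd // Euclid_dvdM // negb_or k3.
by rewrite nrm_1subq !n3; [ring|lia|lia].
Qed.

Lemma qodd_near1 : near1 (fun i => 1 - q ^+ (2 * i).+1).
Proof. by apply: near1_subq => n; lia. Qed.

Lemma qneg_near1 : near1 (fun i => 1 + q ^+ i.+1).
Proof. exact: near1_addq. Qed.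

Lemma qneg12_near1 :
  near1 (fun i => (1 + q ^+ (3 * i).+1) * (1 + q ^+ (3 * i).+2)).
Proof. by apply: near1M; apply: near1_addq => n; lia. Qed.

Lemma qodd15_near1 :
  near1 (fun i => (1 - q ^+ (6 * i).+1) * (1 - q ^+ (6 * i + 5))).
Proof. by apply: near1M; apply: near1_subq => n; lia. Qed.

Lemma qodd_euler : qodd * euler 2 = euler 1.
Proof.
rewrite qodd.unlock euler.unlock -iprodM; [|exact: qodd_near1|exact: euler_near1].
rewrite -[RHS]iprod2; last exact: euler_near1.
by apply: eq_iprod => i; rewrite !mul1n; congr (_ * (1 - q ^+ _)); lia.
Qed.

Lemma qneg_euler : qneg * euler 1 = euler 2.
Proof.
rewrite qneg.unlock euler.unlock -iprodM; [|exact: qneg_near1|exact: euler_near1].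
by apply: eq_iprod => i; rewrite mul1n mulnC exprM; ring.
Qed.

(** Euler's identity between partitions into odd parts and into distinct parts. *)
Lemma qodd_qneg : qodd * qneg = 1.
Proof.
apply: (mulI_unit (euler0 1)).
by rewrite mulrCA (mulrC _ qneg) qneg_euler qodd_euler mulr1.
Qed.

Lemma qneg12_V : qneg12 * V qneg = qneg.
Proof.
rewrite qneg12.unlock qneg.unlock V_iprod; last exact: qneg_near1.
rewrite -iprodM; [|exact: qneg12_near1|by apply: near1V; exact: qneg_near1].
rewrite -[RHS]iprod3; last exact: qneg_near1.
apply: eq_iprod => i; rewrite rmorphD rmorph1 /= Vqn.
by congr (_ * (1 + q ^+ _)); lia.
Qed.

Lemma qodd15_V : qodd15 * V qodd = qodd.
Proof.
rewrite qodd15.unlock qodd.unlock V_iprod; last exact: qodd_near1.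
rewrite -iprodM; [|exact: qodd15_near1|by apply: near1V; exact: qodd_near1].
rewrite -[RHS]iprod3; last exact: qodd_near1.
apply: eq_iprod => i; rewrite rmorphB rmorph1 /= Vqn mulrAC.
by congr ((1 - q ^+ _) * (1 - q ^+ _) * (1 - q ^+ _)); lia.
Qed.

(** Euler's identity divided by its image under [V]. *)
Lemma qneg12_qodd15 : qneg12 * qodd15 = 1.
Proof.
have V1 : V qodd * V qneg = 1 by rewrite -rmorphM /= qodd_qneg rmorph1.
rewrite -[LHS]mulr1 -V1.
have -> : qneg12 * qodd15 * (V qodd * V qneg) = (qodd15 * V qodd) * (qneg12 * V qneg).
  by ring.
by rewrite qodd15_V qneg12_V qodd_qneg.
Qed.

End EulerProducts.

(** * Dissection of f_1 f_2 *)

Lemma double_binS2 (n : nat) : 2 * 'C(n.+1, 2)%:Z = n%:Z * (n%:Z + 1).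
Proof. by elim: n => // n IH; rewrite binS bin1 PoszD mulrDr IH; lia. Qed.

Lemma double_bin2 (n : nat) : 2 * 'C(n, 2)%:Z = n%:Z * (n%:Z - 1).
Proof. by case: n => // n; rewrite double_binS2; lia. Qed.

Section ThetaExponents.
Variables (i j : nat) (k : int).

Definition theta_exponent : nat :=
  match k with
  | Posz n => i * 'C(n.+1, 2) + j * 'C(n, 2)
  | Negz n => i * 'C(n.+1, 2) + j * 'C(n.+2, 2)
  end.

Lemma theta_exponentE :
  2 * theta_exponent%:Z = i%:Z * (k * (k + 1)) + j%:Z * (k * (k - 1)).
Proof.
rewrite /theta_exponent; case: k => n.
  by rewrite -double_binS2 -double_bin2; lia.
have -> : Negz n * (Negz n + 1) = n%:Z * (n%:Z + 1) by rewrite NegzE; lia.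
have -> : Negz n * (Negz n - 1) = n.+1%:Z * (n.+1%:Z + 1) by rewrite NegzE; lia.
by rewrite -!double_binS2; lia.
Qed.

(** Exponents are compared through their doubles, which are polynomials in [k] whatever its sign;
    this leaves only integer arithmetic to the callers. *)
Lemma theta_expr (R : comNzRingType) (x : R) (e : nat) :
  2 * e%:Z = i%:Z * (k * (k + 1)) + j%:Z * (k * (k - 1)) ->
  theta (x ^+ i) (x ^+ j) k = x ^+ e.
Proof.
rewrite -theta_exponentE => ek; have -> : e = theta_exponent by lia.
by rewrite /theta /theta_exponent; case: k => n; rewrite -!exprM -exprD.
Qed.

End ThetaExponents.

Section CubicPartitionDissection.
Variable R : comNzRingType.
Local Notation q := (q R).
Local Notation euler := (euler R).
Local Notation qodd := (qodd R).
Local Notation qneg := (qneg R).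
Local Notation qneg12 := (qneg12 R).
Local Notation qodd15 := (qodd15 R).

Lemma tends_shift (s : nat -> fps R) f : tends (fun n => s n.+1) f -> tends s f.
Proof.
move=> sf N; have [M HM] := sf N; exists M.+1 => [[|m]] //; exact: HM.
Qed.

Lemma eqm_q k : (0 < k)%N -> eqm 1 (q ^+ k) 0.
Proof. by move=> k0; rewrite -[q ^+ k]mulr1; apply: eqm_qn. Qed.

Lemma tends_theta_euler (a b : fps R) k P : (0 < k)%N -> a * b = q ^+ k ->
  tends (prodn (fun s => (1 + a * (q ^+ k) ^+ s) * (1 + b * (q ^+ k) ^+ s))) P ->
  tends (bsum (theta a b)) (P * euler k).
Proof.
move=> k0 ab tP; rewrite -pochinf_euler -ab; apply: triple_product.
  by rewrite ab; apply: eqm_q.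
by rewrite ab.
Qed.

(* phi(-q), and twice psi(q): the bilateral sum of q^(k(k-1)/2) visits each
   triangular number twice. *)
Definition phi := qodd ^+ 2 * euler 2.
Definition psi2 := 2%:R * qneg ^+ 2 * euler 1.
(** [thetaA] and [thetaO] are the product sides of Ramanujan's f(q, q^2) and f(-q, -q^5), the theta
    functions that appear when psi(q) and phi(-q) are split modulo 3. *)
Definition thetaA := qneg12 * euler 3.
Definition thetaO := qodd15 * euler 6.

Lemma tends_qodd : tends (prodn (fun i => 1 - q ^+ (2 * i).+1)) qodd.
Proof. rewrite qodd.unlock; exact: tends_iprod (@qodd_near1 R). Qed.

Lemma tends_qneg : tends (prodn (fun i => 1 + q ^+ i.+1)) qneg.
Proof. rewrite qneg.unlock; exact: tends_iprod (@qneg_near1 R). Qed.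

Lemma tends_phi : tends (bsum (theta (- q) (- q))) phi.
Proof.
apply: tends_theta_euler; [by []|by ring|].
apply: eq_tends (tendsX 2 tends_qodd) => n.
rewrite expr2 -prodnM; apply: eq_prodn => s.
by rewrite -exprM exprS; ring.
Qed.

Lemma tends_psi2 : tends (bsum (theta 1 q)) psi2.
Proof.
apply: tends_theta_euler; [by []|by ring|].
have t1 := tends_qneg.
(* The factor at s = 0 is the 2 in [psi2]; the remaining ones are those of [qneg], one index
   later. *)
have t0 : tends (prodn (fun s => 1 + q ^+ s)) (2%:R * qneg).
  apply: tends_shift; apply: eq_tends (tendsM (@tends_cst _ 2%:R) t1) => n.
  by rewrite /prodn [RHS]big_ord_recl expr0.
rewrite expr2 mulrA; apply: eq_tends (tendsM t0 t1) => n.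
rewrite -prodnM; apply: eq_prodn => s.
by rewrite -exprM mul1n exprS; ring.
Qed.

Lemma tends_thetaA : tends (bsum (theta q (q ^+ 2))) thetaA.
Proof.
apply: tends_theta_euler; [by []|by ring|].
rewrite qneg12.unlock; apply: eq_tends (tends_iprod (@qneg12_near1 R)) => n.
apply: eq_prodn => s.
by rewrite -exprM (exprS q (3 * s).+1) (exprS q (3 * s)); ring.
Qed.

Lemma tends_thetaO : tends (bsum (theta (- q) ((- q) ^+ 5))) thetaO.
Proof.
apply: tends_theta_euler; [by []|by ring|].
rewrite qodd15.unlock; apply: eq_tends (tends_iprod (@qodd15_near1 R)) => n.
apply: eq_prodn => s.
by rewrite -exprM (exprS q (6 * s)) exprD; ring.
Qed.

Lemma phi_psi2 : phi * psi2 = 2%:R * (euler 1 * euler 2).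
Proof.
have -> : phi * psi2 = 2%:R * ((qodd * euler 2) * (qneg * euler 1) * (qodd * qneg)).
  by rewrite /phi /psi2; ring.
by rewrite qodd_euler qneg_euler qodd_qneg mulr1.
Qed.

Lemma thetaA_thetaO : thetaA * thetaO = euler 3 * euler 6.
Proof.
by rewrite /thetaA /thetaO mulrACA qneg12_qodd15 mul1r.
Qed.

Lemma bsum_V (e : int -> fps R) n : V (bsum e n) = bsum (fun k => V (e k)) n.
Proof. exact: rmorph_sum. Qed.

Lemma bsumM (c : fps R) (e : int -> fps R) n :
  c * bsum e n = bsum (fun k => c * e k) n.
Proof. exact: big_distrr. Qed.

Lemma V_theta_expr (x : fps R) i j k : V x = x ^+ 3 ->
  V (theta (x ^+ i) (x ^+ j) k) = x ^+ (3 * theta_exponent i j k).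
Proof.
move=> Vx; rewrite (theta_expr x (theta_exponentE i j k)).
by rewrite rmorphXn /= Vx exprM.
Qed.

Lemma VNq : V (- q) = (- q) ^+ 3.
Proof. by rewrite rmorphN /= Vq; ring. Qed.

(** The terms are (-q)^(k^2), and (3k -+ 1)^2 = 3(3k^2 -+ 2k) + 1, where 3k^2 - 2k is the exponent
    of f(-q, -q^5) at k and 3k^2 + 2k the one at -k. *)
Lemma phi_term k :
  theta (- q) (- q) (3 * k - 1) + theta (- q) (- q) (3 * k) +
    theta (- q) (- q) (3 * k + 1) =
  V (V (theta (- q) (- q) k)) +
    - q * (V (theta (- q) ((- q) ^+ 5) (- k)) + V (theta (- q) ((- q) ^+ 5) k)).
Proof.
have E i : theta (- q) ((- q) ^+ i) = theta ((- q) ^+ 1) ((- q) ^+ i) by [].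
rewrite !(E 5) !(E 1) !(V_theta_expr _ _ _ VNq) mulrDr -!exprS.
rewrite rmorphXn /= VNq -exprM.
rewrite (@theta_expr 1 1 _ _ _ (3 * theta_exponent 1 5 k).+1); last first.
  by have := theta_exponentE 1 5 k; nia.
rewrite (@theta_expr 1 1 _ _ _ (3 * (3 * theta_exponent 1 1 k))); last first.
  by have := theta_exponentE 1 1 k; nia.
rewrite (@theta_expr 1 1 _ _ _ (3 * theta_exponent 1 5 (- k)).+1); last first.
  by have := theta_exponentE 1 5 (- k); nia.
by move: (_ ^+ _) (_ ^+ _) (_ ^+ _) => x y z; ring.
Qed.

Lemma le3S n : (n <= (3 * n).+1)%N. Proof. lia. Qed.

Lemma phi_dissect : phi = V (V phi) - 2%:R * q * V thetaO.
Proof.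
apply: tends_uniq (tends_sub le3S tends_phi) _.
have tO := tendsV tends_thetaO.
have tO2 := tendsM (@tends_cst _ (- q)) (tendsD tO tO).
have -> : V (V phi) - 2%:R * q * V thetaO =
   V (V phi) + (- q) * (V thetaO + V thetaO) by ring.
apply: eq_tends (tendsD (tendsV (tendsV tends_phi)) tO2) => n.
rewrite bsum3 !bsum_V -[X in _ * (X + _)]bsumN -bsumD bsumM -bsumD.
by apply: eq_bsum => k; rewrite phi_term.
Qed.

(** The exponent k(k - 1)/2 becomes 9k(k - 1)/2 + 1 at 3k - 1, and 3(3k^2 -+ k)/2 at 3k and 3k + 1,
    the latter two being three times the exponents of f(q, q^2) at k and -k. *)
Lemma psi2_term k :
  theta 1 q (3 * k - 1) + theta 1 q (3 * k) + theta 1 q (3 * k + 1) =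
  V (theta q (q ^+ 2) k) + V (theta q (q ^+ 2) (- k)) + q * V (V (theta 1 q k)).
Proof.
have E : theta 1 q = theta (q ^+ 0) (q ^+ 1) by [].
rewrite E (_ : theta q = theta (q ^+ 1)) // !(V_theta_expr _ _ _ (@Vq R)).
rewrite rmorphXn /= Vq -exprM -exprS.
rewrite (@theta_expr 0 1 _ _ _ (3 * (3 * theta_exponent 0 1 k)).+1); last first.
  by have := theta_exponentE 0 1 k; nia.
rewrite (@theta_expr 0 1 _ _ _ (3 * theta_exponent 1 2 k)); last first.
  by have := theta_exponentE 1 2 k; nia.
rewrite (@theta_expr 0 1 _ _ _ (3 * theta_exponent 1 2 (- k))); last first.
  by have := theta_exponentE 1 2 (- k); nia.
by move: (_ ^+ _) (_ ^+ _) (_ ^+ _) => x y z; ring.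
Qed.

Lemma psi2_dissect : psi2 = 2%:R * V thetaA + q * V (V psi2).
Proof.
apply: tends_uniq (tends_sub le3S tends_psi2) _.
have tA := tendsV tends_thetaA.
have tp := tendsM (@tends_cst _ q) (tendsV (tendsV tends_psi2)).
rewrite mulr_natl mulr2n; apply: eq_tends (tendsD (tendsD tA tA) tp) => n.
rewrite bsum3 !bsum_V -[X in _ + X + _]bsumN -bsumD bsumM -bsumD.
by apply: eq_bsum => k; rewrite psi2_term.
Qed.

End CubicPartitionDissection.

(** * The cubic equation *)

Lemma fps_double_inj (f g : fps int) : 2%:R * f = 2%:R * g -> f = g.
Proof.
move=> fg; apply: fpsP => n.
have H (h : fps int) : (2%:R * h) n = h n + h n by rewrite mulr_natl mulr2n fcoefD.
have := H f; rewrite fg H; move: (f n) (g n) => x y; lia.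
Qed.

Definition cub : fps int := euler int 1 * euler int 2.

Lemma V_cub : V cub = euler int 3 * euler int 6.
Proof. by rewrite rmorphM /= !V_euler. Qed.

Lemma cub0 : cub 0 = 1.
Proof. by rewrite fcoefM0 !euler0. Qed.

Lemma nrm_cub : nrm cub * V cub = cub ^+ 4.
Proof. by rewrite V_cub nrmM mulrACA !nrm_euler // exprMn. Qed.

(** In 2D = [phi * psi2] the middle class collects 2q V(V D) from the two outer series and -4q V(V
    D) from [thetaO] and [thetaA]; halving leaves -q V(V D). The remaining two products give [a] and
    [c]. *)
Lemma cub_dissect : exists a c : fps int,
  cub = V a - q int * V (V cub) + q int ^+ 2 * V c /\
  a * c = - (V cub) ^+ 2 *+ 2.
Proof.
have := thetaA_thetaO int; have := phi_psi2 int; rewrite -V_cub -/cub.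
move: (phi_dissect int) (psi2_dissect int); move: cub (phi int) (psi2 int).
move: (thetaA int) (thetaO int) => A O D f g fE gE fg AO.
have VAO : V A * V O = V (V D) by rewrite -rmorphM AO.
have Vfg : V f * V g = 2%:R * V D by rewrite -!rmorphM /= fg rmorphM rmorph_nat.
have VVfg : V (V f) * V (V g) = 2%:R * V (V D).
  by rewrite -!rmorphM /= fg !rmorphM !rmorph_nat.
exists (V f * A), (- (O * V g)); split.
  apply: fps_double_inj; rewrite -fg {1}fE {1}gE rmorphN !rmorphM /=.
  move: (V (V f)) (V (V g)) (V A) (V O) (V (V D)) VAO VVfg => x y z w d zw xy.
  by ring: zw xy.
by move: (V f) (V g) (V D) Vfg AO => x y d xy AO; ring: AO xy.
Qed.

Section CubicEquation.
Variable R : comNzRingType.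
Local Notation q := (q R).
Variables D a c : fps R.
Hypothesis D0 : D 0 = 1.
Hypothesis nrmD : nrm D * V D = D ^+ 4.
Hypothesis dissectD : D = V a - q * V (V D) + q ^+ 2 * V c.
Hypothesis ac : a * c = - (V D) ^+ 2 *+ 2.

Let Di := fps_inv D.
Let G := V D.
Let Gi := V Di.
Let E := V G.

Definition eta := q * E * Di.
Definition tee := q * (G * Di) ^+ 4.

Lemma DDi : D * Di = 1. Proof. exact: mul_fps_inv. Qed.
Lemma GGi : G * Gi = 1. Proof. by rewrite -rmorphM DDi rmorph1. Qed.

Lemma E0 : E 0 = 1. Proof. by []. Qed.

Lemma Vac : V a * V c = - E ^+ 2 *+ 2.
Proof. by rewrite -rmorphM ac rmorphMn rmorphN rmorphXn. Qed.

Lemma V_tee : V tee = q ^+ 3 * E ^+ 4 * Gi ^+ 4.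
Proof. by rewrite /tee rmorphM /= Vq rmorphXn /= rmorphM /= exprMn mulrA. Qed.

Lemma nrm_dissectD : nrm D = a ^+ 3 + q ^+ 2 * c ^+ 3 - q * G ^+ 3 *+ 7.
Proof.
rewrite dissectD (_ : V a - q * V (V D) = V a + q * V (- G)); last first.
  by rewrite rmorphN /= mulrN.
rewrite nrm_dissect; have := ac; rewrite -/G => ac'; ring: ac'.
Qed.

(** Put x = V a + q^2 V c, so D = x - qE. The left side is x^3 + 6 q^2 E^2 x - 7 q^3 E^3, and V a *
    V c = -2 E^2 makes the linear term cancel the cross terms of x^3. This cancellation dictates the
    coefficients 3 and 9. *)
Lemma V_nrmD : D ^+ 3 + q * E * D ^+ 2 *+ 3 + q ^+ 2 * E ^+ 2 * D *+ 9 = V (nrm D).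
Proof.
have VD : D = V a - q * E + q ^+ 2 * V c by exact: dissectD.
rewrite nrm_dissectD rmorphB rmorphD rmorphMn !rmorphM ?rmorphXn /= Vq -/E VD.
have := Vac; move: (V a) (V c) E => x y z xy; ring: xy.
Qed.

(** [V_nrmD] divided by D^3: its right side becomes G^4 / (E D^3), which is [eta ^+ 3] over
    [V tee]. *)
Lemma cubic_eta : eta ^+ 3 = V tee * (1 + eta *+ 3 + eta ^+ 2 *+ 9).
Proof.
have VnE : V (nrm D) * E = G ^+ 4 by rewrite -rmorphM nrmD rmorphXn.
have := V_nrmD; rewrite V_tee /eta; move: DDi GGi VnE.
move: D Di G Gi E (V _) => d di g gi e n ddi ggi ne dn.
have -> : 1 + q * e * di *+ 3 + (q * e * di) ^+ 2 *+ 9 = di ^+ 3 * n.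
  by rewrite -dn; ring: ddi.
have -> : q ^+ 3 * e ^+ 4 * gi ^+ 4 * (di ^+ 3 * n) =
   (q * e * di) ^+ 3 * (n * e) * gi ^+ 4 by ring.
by rewrite ne -[_ * _ * gi ^+ 4]mulrA -exprMn ggi expr1n mulr1.
Qed.

(* [teeu] and [teeuu] stand for [V tee / eta] and [V tee / eta ^+ 2]. *)
Let teeu := q ^+ 2 * E ^+ 3 * Gi ^+ 4 * D.
Let teeuu := q * E ^+ 2 * Gi ^+ 4 * D ^+ 2.

Lemma qE_cancel x y : q * E * x = q * E * y -> x = y.
Proof.
by rewrite -!mulrA => /(@q_cancel _ 1) /(mulI_unit E0).
Qed.

(** The cubic divided by [eta]. As [eta] is not a unit, both sides are multiplied by q E =
    [eta * D], which can be cancelled. *)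
Lemma eta2_eq : eta ^+ 2 = teeu + V tee *+ 3 + V tee * eta *+ 9.
Proof.
apply: qE_cancel.
have etaD : q * E = eta * D by rewrite /eta -mulrA (mulrC Di) DDi mulr1.
have -> : q * E * eta ^+ 2 = eta ^+ 3 * D by rewrite etaD; ring.
rewrite cubic_eta.
have -> : q * E * (teeu + V tee *+ 3 + V tee * eta *+ 9) =
    q * E * teeu + eta * D * (V tee *+ 3 + V tee * eta *+ 9).
  by rewrite -etaD; ring.
have -> : q * E * teeu = V tee * D by rewrite V_tee /teeu; ring.
by ring.
Qed.

Lemma eta_eq : eta = teeuu + teeu *+ 3 + V tee *+ 9.
Proof.
apply: qE_cancel.
have etaD : q * E = eta * D by rewrite /eta -mulrA (mulrC Di) DDi mulr1.
have -> : q * E * eta = eta ^+ 2 * D by rewrite etaD; ring.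
rewrite eta2_eq.
have -> : q * E * (teeuu + teeu *+ 3 + V tee *+ 9) =
    q * E * teeuu + q * E * teeu *+ 3 + eta * D * V tee *+ 9.
  by rewrite -etaD; ring.
have -> : q * E * teeu = V tee * D by rewrite V_tee /teeu; ring.
have -> : q * E * teeuu = teeu * D by rewrite /teeu /teeuu; ring.
by ring.
Qed.

Lemma res3_teeu : res3 0 teeu = - tee.
Proof.
have -> : teeu = V (G ^+ 3 * Di ^+ 4) * (q ^+ 2 * D).
  by rewrite rmorphM !rmorphXn -/E -/Gi /teeu; ring.
(* The factor q^2 moves the middle term -qE to -q^3 E, the only part that U keeps. *)
have -> : q ^+ 2 * D = V (- q * G) + q * V (q * c) + q ^+ 2 * V a.
  rewrite {1}dissectD !rmorphM rmorphN /= Vq -/G; ring.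
by rewrite res3_VM res3_dissect /tee; ring.
Qed.

Lemma res3_teeuu : res3 0 teeuu = - tee *+ 3.
Proof.
have -> : teeuu = V (G ^+ 2 * Di ^+ 4) * (q * D ^+ 2).
  by rewrite rmorphM !rmorphXn -/E -/Gi /teeuu; ring.
(* The part of D^2 with exponents 2 modulo 3 is q^2 (E^2 + 2 V a * V c) = -3 q^2 E^2, and the factor
   q moves it into class 0. *)
have -> : q * D ^+ 2 = V (- q * G ^+ 2 *+ 3) + q * V (a ^+ 2 - q * G * c *+ 2)
    + q ^+ 2 * V (q * c ^+ 2 - a * G *+ 2).
  have VD : D = V a - q * E + q ^+ 2 * V c by exact: dissectD.
  rewrite {1}VD !rmorphB /= !rmorphMn /= !rmorphM rmorphN ?rmorphXn /= Vq -/E.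
  have := Vac; move: (V a) (V c) E => x y z xy; ring: xy.
by rewrite res3_VM res3_dissect /tee; ring.
Qed.

Lemma res3_eta : res3 0 eta = tee *+ 3.
Proof.
by rewrite eta_eq !raddfD ?raddfMn /= res3_V res3_teeu res3_teeuu; ring.
Qed.

Lemma res3_eta2 : res3 0 (eta ^+ 2) = tee *+ 2 + tee ^+ 2 *+ 27.
Proof.
by rewrite eta2_eq !raddfD ?raddfMn /= res3_V res3_VM res3_teeu res3_eta; ring.
Qed.

End CubicEquation.

(** * The recurrence *)

Lemma mm0 i : mm i 0 = 0.
Proof. by case: i => [|[|[|[|i]]]]. Qed.

Lemma mm_gt i j : (i < j)%N -> mm i j = 0.
Proof.
case: i => [|[|[|[|i]]]] //; last by move=> ij; rewrite /= ij.
- by case: j => [|[|j]].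
- by case: j => [|[|[|j]]].
- by case: j => [|[|[|[|j]]]].
Qed.

(** Both guards of the definition are automatic: the right side vanishes for large [j] by
    triangularity, and for [j = 0] because column 0 is zero. *)
Lemma mm_rec i j :
  mm i.+4 j.+1 = 9 * mm i.+3 j + 3 * mm i.+2 j + mm i.+1 j.
Proof.
have [ij|ij] := ltnP i.+3 j.
  by rewrite !mm_gt //; lia.
have E : mm i.+4 j.+1 = if (i.+4 < j.+1)%N then 0 else
  if j is 0 then 0 else 9 * mm i.+3 j + 3 * mm i.+2 j + mm i.+1 j by case: (j).
rewrite E ltnS ltnNge ij; case: j {ij E} => [|j]; last by [].
by rewrite !mm0.
Qed.

(** A step of the recurrence lowers [j] by 1 and [i] by at most 3. Hence row 4i vanishes up to
    column i, and [cc] loses no entry of it. *)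
Lemma mm_small i j : (3 * j < i)%N -> mm i j = 0.
Proof.
elim/ltn_ind: i j => i IH [|j]; first by rewrite mm0.
case: i IH => [|[|[|[|i]]]] IH // ij; try lia.
by rewrite mm_rec !IH //; lia.
Qed.

Lemma Y_gt alpha j : (3 ^ alpha < j)%N -> Y alpha j = 0.
Proof.
case: alpha => [|alpha] /= aj; first by case: j aj => [|[|j]].
rewrite big_nat big1 // => i /andP[_ ia]; rewrite /cc mm_gt ?mulr0 //.
by move: aj; rewrite expnS; lia.
Qed.

Lemma fcoef_intM (z : int) (f : fps int) n : (z%:~R * f) n = z * f n.
Proof.
rewrite mulrzl; case: z => m; rewrite ?NegzE ?mulrNz ?fcoefN -!pmulrn fcoefMn.
  by rewrite -mulr_natl natz.
by rewrite -mulr_natl natz mulNr.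
Qed.

Lemma res3_intM (z : int) (f : fps int) : res3 0 (z%:~R * f) = z%:~R * res3 0 f.
Proof. by rewrite !mulrzl raddfMz. Qed.

Section Powers.
Variable R : comNzRingType.
Local Notation q := (q R).
Variables D a c : fps R.
Hypothesis D0 : D 0 = 1.
Hypothesis nrmD : nrm D * V D = D ^+ 4.
Hypothesis dissectD : D = V a - q * V (V D) + q ^+ 2 * V c.
Hypothesis ac : a * c = - (V D) ^+ 2 *+ 2.

Local Notation eta := (eta D).
Local Notation tee := (tee D).

Lemma mm_sum_widen k K : (k < K)%N ->
  \sum_(j < K) (mm k j)%:~R * tee ^+ j = \sum_(j < k.+1) (mm k j)%:~R * tee ^+ j.
Proof.
move=> kK; rewrite (big_ord_widen K (fun j => (mm k j)%:~R * tee ^+ j) kK).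
rewrite [RHS]big_mkcond; apply: eq_bigr => j _; case: ltnP => // kj.
by rewrite mm_gt // mulr0z mul0r.
Qed.

Lemma res3_eta_exp k K : (0 < k < K)%N ->
  res3 0 (eta ^+ k) = \sum_(j < K) (mm k j)%:~R * tee ^+ j.
Proof.
elim/ltn_ind: k K => -[|[|[|k]]] // IH K /andP[_ kK].
- rewrite mm_sum_widen // !big_ord_recl big_ord0 /= expr1.
  rewrite (res3_eta D0 nrmD dissectD ac) /bump /=; ring.
- rewrite mm_sum_widen // !big_ord_recl big_ord0 /=.
  rewrite (res3_eta2 D0 nrmD dissectD ac) /bump /=; ring.
have -> : eta ^+ k.+3 =
    V tee * (eta ^+ k + (eta ^+ k.+1 *+ 3 + eta ^+ k.+2 *+ 9)).
  rewrite -(addn3 k) exprD (cubic_eta D0 nrmD dissectD ac) (exprSr eta k.+1).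
  by rewrite (exprSr eta k); move: (V _) => t; ring.
have res3_9 f g h : res3 0 (f + (g *+ 3 + h *+ 9)) =
    res3 0 f + (res3 0 g *+ 3 + res3 0 h *+ 9) by [].
rewrite res3_VM res3_9.
(* The cube is treated apart: it involves U(1) = 1, whereas row 0 of [mm] is zero. *)
case: k IH kK => [|k] IH kK.
  rewrite mm_sum_widen // !big_ord_recl big_ord0 /bump /= !expr0 expr1.
  rewrite (res3_eta D0 nrmD dissectD ac) (res3_eta2 D0 nrmD dissectD ac).
  by rewrite -(rmorph1 (@V R)) res3_V rmorph1; ring.
case: K kK => // K kK; rewrite (IH k.+1 _ K) ?(IH k.+2 _ K) ?(IH k.+3 _ K); try lia.
move: (mm_rec k) (mm0 k.+4); move: (mm k.+4) (mm k.+3) (mm k.+2) (mm k.+1).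
move=> m4 m3 m2 m1 m4E m40.
rewrite big_ord_recl m40 mul0r add0r -!sumrMnl -!big_split big_distrr /=.
by apply: eq_bigr => j _; rewrite /bump add1n m4E exprS !rmorphD !rmorphM /=; ring.
Qed.

Lemma eta4 : eta ^+ 4 = tee * V tee.
Proof.
rewrite (V_tee D) /eta /tee; have := GGi D0.
move: (fps_inv D) (V D) (V (fps_inv D)) (V (V D)) => di g gi e ggi; ring: ggi.
Qed.

Lemma tee_cancel i (x y : fps R) : tee ^+ i * x = tee ^+ i * y -> x = y.
Proof.
rewrite /tee exprMn -!mulrA => /q_cancel; apply: mulI_unit.
have H (f : fps R) k : f 0 = 1 -> (f ^+ k) 0 = 1.
  by move=> f0; elim: k => [|k IH]; rewrite ?fcoef1_0 // exprS fcoefM0 f0 IH mulr1.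
apply: (H); apply: (H); rewrite fcoefM0 V0 D0 mul1r.
by have := congr1 (fun f : fps R => f 0) (DDi D0); rewrite fcoefM0 D0 mul1r fcoef1_0.
Qed.

(** T^i U(T^i) = U(T(q^3)^i T^i) = U(eta^(4i)), whose expansion is divisible by T^i; cancelling T^i
    shifts the columns by i. The bound [M] is free so that all rows can share one range. *)
Lemma res3_tee_exp i M : (0 < i)%N -> (3 * i <= M)%N ->
  res3 0 (tee ^+ i) = \sum_(1 <= j < M.+1) (cc i j)%:~R * tee ^+ j.
Proof.
move=> i0 iM; apply: (@tee_cancel i).
rewrite -res3_VM rmorphXn -exprMn (mulrC _ tee) -eta4 -exprM.
rewrite (@res3_eta_exp _ (i.+1 + M)); last by lia.
rewrite big_split_ord /= big1 => [|j _]; last first.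
  by rewrite mm_small ?mulr0z ?mul0r //; have := ltn_ord j; lia.
rewrite add0r big_add1 big_mkord big_distrr; apply: eq_bigr => j _ /=.
by rewrite /cc addSnnS exprD mulrCA.
Qed.

End Powers.

(** * Iteration of U on eta *)

Section Cub.
Local Notation eta := (eta cub).
Local Notation tee := (tee cub).

Lemma iter_res3_eta alpha : iter alpha.+1 (@res3 int 0) eta =
  \sum_(1 <= i < (3 ^ alpha).+1) (Y alpha i)%:~R * tee ^+ i.
Proof.
have [a [c [dc ac]]] := cub_dissect.
elim: alpha => [|alpha IH].
  by rewrite /= big_nat1 (res3_eta cub0 nrm_cub dc ac) expr1 mulr_natl.
rewrite iterS IH raddf_sum /=.
have H i : (1 <= i < (3 ^ alpha).+1)%N -> res3 0 ((Y alpha i)%:~R * tee ^+ i) =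
  \sum_(1 <= j < (3 ^ alpha.+1).+1) (Y alpha i * cc i j)%:~R * tee ^+ j.
  move=> /andP[i0 ia]; rewrite res3_intM.
  rewrite (@res3_tee_exp _ _ a c cub0 nrm_cub dc ac i (3 ^ alpha.+1)) //; last first.
    by rewrite expnS; lia.
  by rewrite big_distrr; apply: eq_bigr => j _; rewrite intrM -mulrA.
rewrite (eq_big_nat _ _ H) exchange_big /=; apply: eq_bigr => j _.
by rewrite -big_distrl rmorph_sum.
Qed.

Lemma iter_res3 k (f : fps int) n : iter k (@res3 int 0) f n = f (3 ^ k * n)%N.
Proof.
elim: k n => [|k IH] n; first by rewrite mul1n.
by rewrite iterS /= IH addn0 expnSr mulnA.
Qed.

End Cub.

(** * Passage to the polynomial truncations *)

Lemma eqm_fk k N : (0 < k)%N -> eqm N.+1 (fps_of (fk k N)) (euler int k).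
Proof.
move=> k0; rewrite /fk rmorph_prod big_add1 big_mkord /= euler.unlock.
have -> : \prod_(i < N) fps_of (1 - 'X^(k * i.+1)) =
    prodn (fun i => 1 - q int ^+ (k * i.+1)) N.
  by apply: eq_bigr => i _; rewrite rmorphB rmorph1 /= fps_ofXn.
exact/eqm_iprod/euler_near1.
Qed.

Lemma eqm_fk_inv k N : (0 < k)%N ->
  eqm N.+1 (fps_of (fk_inv k N)) (fps_inv (euler int k)).
Proof.
move=> k0; have H : eqm N.+1 (fps_of (fk k N) * fps_of (fk_inv k N)) 1.
  rewrite -rmorphM /fk /fk_inv -big_split rmorph_prod /=.
  rewrite big_nat; apply: (big_ind (fun f => eqm N.+1 f 1)) => // [x y x1 y1|m].
    by rewrite -[1]mulr1; apply: eqmM.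
  move=> /andP[m0 _].
  (* The finite geometric sum misses the inverse by a term of degree km(N + 1), beyond the order
     considered. *)
  have -> : (1 - 'X^(k * m)) * (\sum_(0 <= j < N.+1) 'X^(k * m * j)) =
      1 - 'X^(k * m * N.+1) :> {poly int}.
    rewrite big_mkord; under eq_bigr do rewrite exprM.
    by rewrite -opprB mulNr -subrX1 opprB -exprM.
  rewrite rmorphB rmorph1 /= fps_ofXn -[X in eqm _ _ X]subr0; apply: eqmB => //.
  by rewrite -[q _ ^+ _]mulr1; apply: eqm_qn; rewrite leq_pmull // muln_gt0 k0.
have e1 := mul_fps_inv (euler0 int k); set g := fps_inv _ in e1 *.
have -> : fps_of (fk_inv k N) = fps_of (fk_inv k N) * euler int k * g.
  by rewrite -mulrA e1 mulr1.
rewrite -[X in eqm _ _ X]mul1r; apply: eqmM => //.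
apply: eqm_trans H; rewrite mulrC; apply: eqmM => //.
exact/eqm_sym/eqm_fk.
Qed.

Lemma cub_inv : fps_inv cub = fps_inv (euler int 1) * fps_inv (euler int 2).
Proof.
apply: (mulI_unit cub0); rewrite mul_fps_inv ?cub0 //.
by rewrite mulrACA !mul_fps_inv ?euler0 // mulr1.
Qed.

Lemma VV_cub : V (V cub) = euler int 9 * euler int 18.
Proof. by rewrite V_cub rmorphM /= !V_euler. Qed.

Lemma a9_eta n : a9 n = eta cub n.+1.
Proof.
rewrite /eta -mulrA -[q int]expr1 fcoef_qnM ltnS ltn0 subSS subn0 VV_cub cub_inv mulrA.
rewrite /a9 -[LHS]/(fps_of _ n) !rmorphM.
by apply: (@eqmM _ n.+1) => //; do ?apply: eqmM; do ?exact: eqm_fk; exact: eqm_fk_inv.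
Qed.

Lemma eqm_Hser N : eqm N.+1 (fps_of (Hser N)) (V cub * fps_inv cub).
Proof.
rewrite V_cub cub_inv mulrA /Hser !rmorphM.
by do ?apply: eqmM; do ?exact: eqm_fk; exact: eqm_fk_inv.
Qed.

(* Coefficientwise: for every alpha and every n, the coefficient of q^n on both
   sides agree.  On the right only i <= n+1 contribute to q^n. *)
Theorem theorem3p2 (alpha n : nat) :
  a9 (3 ^ alpha.+1 * n + 3 ^ alpha.+1 - 1)%N =
  (\sum_(1 <= i < n.+2) Y alpha i *: ('X^(i.-1) * Hser n ^+ (4 * i)))`_n.
Proof.
(* The factor q in [eta] shifts the index by one, turning the class of -1 modulo 3^(alpha + 1) into
   the class of 0 that iterated U selects. *)
have n3 : (3 ^ alpha.+1 * n + 3 ^ alpha.+1 - 1).+1 = (3 ^ alpha.+1 * n.+1)%N.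
  by rewrite mulnS addnC subn1 prednK // ltn_addr // expn_gt0.
rewrite a9_eta n3 -iter_res3 iter_res3_eta fcoef_sum coef_sum.
pose F i := Y alpha i * (tee cub ^+ i) n.+1.
rewrite (eq_bigr F) => [|i _]; last exact: fcoef_intM.
rewrite [RHS](eq_big_nat _ _ (F2 := F)) => [|i /andP[i0 _]]; last first.
  have teeX : tee cub ^+ i = q int ^+ i * (V cub * fps_inv cub) ^+ (4 * i).
    by rewrite /tee exprMn exprM.
  rewrite coefZ /F teeX; congr (_ * _).
  have HX : fps_of ('X^(i.-1) * Hser n ^+ (4 * i)) =
      q int ^+ i.-1 * fps_of (Hser n) ^+ (4 * i).
    by rewrite rmorphM /= fps_ofXn rmorphXn.
  rewrite fcoef_qnM -[LHS]/(fps_of _ n) HX.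
  rewrite fcoef_qnM -(prednK i0) ltnS subSS; case: ifP => // _.
  by apply: (@eqmX _ n.+1 _ _ _ (@eqm_Hser n)); lia.
have FY i : (3 ^ alpha < i)%N -> F i = 0 by move=> ia; rewrite /F Y_gt // mul0r.
have Fn i : (n.+1 < i)%N -> F i = 0.
  by move=> ni; rewrite /F /tee exprMn fcoef_qnM ni mulr0.
(* One sum stops at 3^alpha, the support of Y, the other at n + 1, beyond which q^i is too high a
   power; both extend by zeros to a common range. *)
have widen m M : (m <= M)%N -> (forall i, (m < i)%N -> F i = 0) ->
    \sum_(1 <= i < M.+1) F i = \sum_(1 <= i < m.+1) F i.
  move=> mM Fm; rewrite (big_cat_nat (n := m.+1)) //= [X in _ + X]big_nat.
  by rewrite [X in _ + X]big1 ?addr0 // => i /andP[/Fm].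
by rewrite -(widen _ _ (leq_addr n.+1 _) FY) (widen _ _ (leq_addl _ n.+1) Fn).
Qed.
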